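(* Let $k\in\mathbb{N}=\{1,2,\dots\}$, $r\in\mathbb{N}_0=\{0,1,2,\dots\}$ and $p\in\mathbb{N}$ with $p\ge r+2$. Then \[ S(k,r+1;p)=\frac{1}{r!}\sum_{l=1}^{r+1}\left[\begin{array}{c} r+1\\ l\end{array}\right]\sum_{\substack{i+j=k\\ i,j\ge 0}}(-1)^i\,\zeta_r^\star(\{1\}_i)\,U_{j,r}(p+1-l). \]
   Context: For a positive integer $n$ and nonnegative integers $s_1,\dots,s_m$, the multiple harmonic numbers and multiple harmonic star numbers are $\zeta_n(s_1,\dots,s_m)=\sum_{n\ge n_1>n_2>\cdots>n_m\ge 1}\frac{1}{n_1^{s_1}\cdots n_m^{s_m}}$ and $\zeta_n^\star(s_1,\dots,s_m)=\sum_{n\ge n_1\ge n_2\ge\cdots\ge n_m\ge 1}\frac{1}{n_1^{s_1}\cdots n_m^{s_m}}$, with $\zeta_n(\emptyset)=\zeta_n^\star(\emptyset)=1$, $\zeta_n(s_1,\dots,s_m)=0$ if $n<m$; for $n=0$ one sets $\zeta_0(\emptyset)=\zeta_0^\star(\emptyset)=1$ and $\zeta_0(\{1\}_j)=\zeta_0^\star(\{1\}_i)=0$ for $i,j\ge1$. The notation $\{a\}_q$ means $a$ repeated $q$ times. For positive integers $m,k,n$ the generalized hyperharmonic numbers are \[h_n^{(m)}(k)=\sum_{\substack{1\le n_{m+k-1}<\cdots<n_{m+1}<n_m\\ \le n_{m-1}\le\cdots\le n_1\le n}}\frac{1}{n_m n_{m+1}\cdots n_{m+k-1}}\] (for $k=1$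 the condition is just $1\le n_m\le n_{m-1}\le\cdots\le n_1\le n$), and $S(k,m;p)=\sum_{n=1}^\infty \frac{h_n^{(m)}(k)}{n^p}$. For integers $j\ge 0$, $r\ge 0$ and $q\ge 2$, $U_{j,r}(q)=\sum_{n=1}^\infty\frac{\zeta_{n+r}(\{1\}_j)}{n^q}$. The unsigned Stirling numbers of the first kind $\left[\begin{array}{c} n\\ k\end{array}\right]$ are defined by $n!\,x(1+x)(1+\frac{x}{2})\cdots(1+\frac{x}{n})=\sum_{k=0}^n\left[\begin{array}{c} n+1\\ k+1\end{array}\right]x^{k+1}$, with $\left[\begin{array}{c} n\\ k\end{array}\right]=0$ for $n<k$, $\left[\begin{array}{c} n\\ 0\end{array}\right]=\left[\begin{array}{c} 0\\ k\end{array}\right]=0$ for $n,k\ge1$, and $\left[\begin{array}{c} 0\\ 0\end{array}\right]=1$. *)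

(* Defs.v *)
From HB Require Import structures.
From mathcomp Require Import all_boot all_order all_algebra.
From mathcomp Require Import all_classical all_reals all_analysis.

Set Implicit Arguments.
Unset Strict Implicit.
Unset Printing Implicit Defensive.

Import Order.TTheory GRing.Theory Num.Theory.
Import numFieldNormedType.Exports.
Local Open Scope ring_scope.

(* Summation indices (n_1, ..., n_m) with n_i <= n are tuples over 'I_n.+1;
   component i of the tuple is n_(i+1), and n_i >= 1 is imposed by
   [positive]. *)
Definition positive (s : seq nat) : bool := all (fun x => 0 < x)%N s.

Definition mzeta_term (R : realType) (n : nat) (s : seq nat)
    (t : (size s).-tuple 'I_n.+1) : R :=
  \prod_(i < size s) ((tnth t i)%:R ^+ nth 0%N s i)^-1.

Definition mzeta (R : realType) (n : nat) (s : seq nat) : R :=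
  \sum_(t : (size s).-tuple 'I_n.+1 |
        positive (map val t) && sorted gtn (map val t)) mzeta_term R t.

Definition mzeta_star (R : realType) (n : nat) (s : seq nat) : R :=
  \sum_(t : (size s).-tuple 'I_n.+1 |
        positive (map val t) && sorted geq (map val t)) mzeta_term R t.

(* h_n^{(m)}(k), for m, k >= 1: [take m] extracts n_1 >= ... >= n_m and
   [drop m.-1] extracts n_m > ... > n_(m+k-1); the two lists share n_m. *)
Definition hyperharmonic (R : realType) (m k n : nat) : R :=
  \sum_(t : (m + k).-1.-tuple 'I_n.+1 |
        [&& positive (map val t), sorted geq (take m (map val t))
          & sorted gtn (drop m.-1 (map val t))])
    \prod_(x <- drop m.-1 (map val t)) (x%:R)^-1.

Definition S_partial (R : realType) (k m p : nat) (N : nat) : R :=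
  \sum_(1 <= n < N) hyperharmonic R m k n / n%:R ^+ p.

Definition S_sum (R : realType) (k m p : nat) : R :=
  limn (S_partial R k m p).

Definition U_partial (R : realType) (j r q : nat) (N : nat) : R :=
  \sum_(1 <= n < N) mzeta R (n + r) (nseq j 1%N) / n%:R ^+ q.

Definition U_sum (R : realType) (j r q : nat) : R :=
  limn (U_partial R j r q).

(* The row n'.+1 is read off as the coefficients of the polynomial
   n'! x (1 + x) (1 + x/2) ... (1 + x/n'). *)
Definition stirling1 (R : realType) (n k : nat) : R :=
  if n is n'.+1 then
    ((n'`!)%:R *: ('X * \prod_(1 <= i < n'.+1) (1 + (i%:R)^-1 *: 'X))
      : {poly R})`_k
  else (k == 0%N)%:R.

(* Main.v *)
(* Write P_N(x) = prod_(1 <= i <= N) (1 + x/i), whose x^j-coefficient is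
   zeta_N({1}_j); the x^i-coefficient of 1 / P_r(x) is (-1)^i zeta*_r({1}_i).
   The r-fold summation of P_n(x) = binom(n + x, n) gives
     h_n^(r+1)(k) = [x^k] binom(n + r + x, n)
                  = binom(n + r, r) [x^k] P_(n+r)(x) / P_r(x),
   and r! binom(n + r, r) = sum_l [r+1, l] n^(l-1). Dividing by n^p and summing
   over n yields the identity already for partial sums; the series U_(j,r)(q)
   converge because zeta_N({1}_j) is at most 2^j P_N(1/2) = O(sqrt N). *)

Require Import Defs.
From HB Require Import structures.
From mathcomp Require Import all_boot all_order all_algebra.
From mathcomp Require Import all_classical all_reals all_analysis.
From mathcomp Require Import ring lra.
Import Order.TTheory GRing.Theory Num.Theory.
Import numFieldNormedType.Exports.
Local Open Scope ring_scope.

(** * Tuple sums as iterated sums *)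

Fixpoint nested_sum {R : pzRingType} (n m : nat) (G : seq nat -> R) : R :=
  if m is m'.+1 then \sum_(0 <= i < n.+1) nested_sum n m' (fun s => G (i :: s))
  else G [::].

Lemma eq_nested_sum {R : pzRingType} (n m : nat) (G H : seq nat -> R) :
  (forall s, size s = m -> G s = H s) -> nested_sum n m G = nested_sum n m H.
Proof.
elim: m G H => [|m IHm] G H GH /=; first exact: GH.
by apply: eq_bigr => i _; apply: IHm => s sm; apply: GH; rewrite /= sm.
Qed.

Lemma nested_sumZ {R : pzRingType} (n m : nat) (c : R) (G : seq nat -> R) :
  nested_sum n m (fun s => c * G s) = c * nested_sum n m G.
Proof.
elim: m G => [|m IHm] G //=.
by rewrite big_distrr /=; apply: eq_bigr => i _; rewrite IHm.
Qed.

(** The indicator kills every term having an entry above [b], so each range shrinks to [b]. This is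
    how an ordering condition on the first index becomes an upper limit for the others. *)
Lemma nested_sum_le {R : pzRingType} (n b m : nat) (G : seq nat -> R) :
  (b <= n)%N ->
  nested_sum n m (fun s => (all (fun x => (x <= b)%N) s)%:R * G s) =
  nested_sum b m G.
Proof.
move=> bn; elim: m G => [|m IHm] G /=; first by rewrite mul1r.
rewrite (@big_cat_nat _ _ _ b.+1) //= [X in _ + X]big1_seq ?addr0; last first.
  move=> i /andP[_]; rewrite mem_index_iota => /andP[bi _].
  rewrite -[RHS](mul0r (nested_sum n m G)) -nested_sumZ.
  by apply: eq_nested_sum => s _; rewrite leqNgt bi /= !mul0r.
apply: eq_big_nat => i /andP[_ ib]; rewrite -IHm.
by apply: eq_nested_sum => s _; rewrite -ltnS ib.
Qed.

Lemma sum_tuple_nested {R : pzRingType} (n m : nat) (G : seq nat -> R) :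
  \sum_(t : m.-tuple 'I_n.+1) G (map val t) = nested_sum n m G.
Proof.
elim: m G => [|m IHm] G /=.
  rewrite (big_pred1 [tuple]) // => t; apply/esym/eqP; exact: tuple0.
rewrite big_mkord (eq_bigr (fun i : 'I_n.+1 =>
  \sum_(t : m.-tuple 'I_n.+1) G (val i :: map val t))); last first.
  by move=> i _; rewrite -IHm.
rewrite pair_big /=.
rewrite (reindex (fun p : 'I_n.+1 * m.-tuple 'I_n.+1 => [tuple of p.1 :: p.2])) //=.
exists (fun t : m.+1.-tuple 'I_n.+1 => (thead t, [tuple of behead t])).
  by case=> i t _ /=; congr pair; apply: val_inj.
by move=> t _ /=; rewrite -tuple_eta.
Qed.

(** * Recurrences for multiple harmonic numbers with unit exponents *)

Definition decr_weight (R : realType) (s : seq nat) : R :=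
  (positive s && sorted gtn s)%:R * \prod_(x <- s) x%:R^-1.

Definition nonincr_weight (R : realType) (s : seq nat) : R :=
  (positive s && sorted geq s)%:R * \prod_(x <- s) x%:R^-1.

Lemma mzeta_term_ones (R : realType) (n j : nat)
    (t : (size (nseq j 1%N)).-tuple 'I_n.+1) :
  mzeta_term R t = \prod_(x <- map val t) x%:R^-1.
Proof.
rewrite big_map big_tuple /mzeta_term; apply: eq_bigr => i _.
have ij : (i < j)%N by rewrite -[X in (_ < X)%N](size_nseq j 1%N).
by rewrite nth_nseq ij expr1.
Qed.

Lemma mzeta_ones_nested (R : realType) (n j : nat) :
  mzeta R n (nseq j 1%N) = nested_sum n j (decr_weight R).
Proof.
rewrite -{2}(size_nseq j 1%N) -sum_tuple_nested /mzeta big_mkcond /=.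
apply: eq_bigr => t _; rewrite mzeta_term_ones /decr_weight.
by case: ifP => _; rewrite ?mul1r ?mul0r.
Qed.

Lemma mzeta_star_ones_nested (R : realType) (n j : nat) :
  mzeta_star R n (nseq j 1%N) = nested_sum n j (nonincr_weight R).
Proof.
rewrite -{2}(size_nseq j 1%N) -sum_tuple_nested /mzeta_star big_mkcond /=.
apply: eq_bigr => t _; rewrite mzeta_term_ones /nonincr_weight.
by case: ifP => _; rewrite ?mul1r ?mul0r.
Qed.

Lemma gtn_trans : transitive gtn.
Proof. by move=> y x z yx zy; apply: (ltn_trans zy yx). Qed.

Lemma geq_trans : transitive geq.
Proof. by move=> y x z yx zy; apply: (leq_trans zy yx). Qed.

Lemma mzeta_ones0 (R : realType) (n : nat) : mzeta R n (nseq 0 1%N) = 1.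
Proof. by rewrite mzeta_ones_nested /= /decr_weight big_nil mulr1. Qed.

Lemma mzeta_star_ones0 (R : realType) (n : nat) :
  mzeta_star R n (nseq 0 1%N) = 1.
Proof. by rewrite mzeta_star_ones_nested /= /nonincr_weight big_nil mulr1. Qed.

(** The largest index n_1 = i+1 is split off; the remaining indices, being strictly smaller, are
    bounded by i. *)
Lemma mzeta_onesS (R : realType) (n j : nat) :
  mzeta R n (nseq j.+1 1%N) =
  \sum_(0 <= i < n) i.+1%:R^-1 * mzeta R i (nseq j 1%N).
Proof.
rewrite mzeta_ones_nested /= big_nat_recl //.
(* The value n_1 = 0, present in the ordinal range, is discarded by positivity. *)
rewrite (eq_nested_sum n j _ (fun s => 0 * decr_weight R s)); last first.
  by move=> s _; rewrite /decr_weight /= !mul0r.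
rewrite nested_sumZ mul0r add0r; apply: eq_big_nat => i /andP[_ ltin].
rewrite mzeta_ones_nested -(@nested_sum_le _ n i) ?(ltnW ltin) // -nested_sumZ.
apply: eq_nested_sum => s _; rewrite /decr_weight /= big_cons.
rewrite (path_sortedE gtn_trans) (eq_all (a2 := fun x => x <= i)%N) //.
by case: all; case: positive; case: sorted; rewrite /= ?(mul0r, mulr0, mul1r).
Qed.

Lemma mzeta_star_onesS (R : realType) (n j : nat) :
  mzeta_star R n (nseq j.+1 1%N) =
  \sum_(0 <= i < n) i.+1%:R^-1 * mzeta_star R i.+1 (nseq j 1%N).
Proof.
rewrite mzeta_star_ones_nested /= big_nat_recl //.
rewrite (eq_nested_sum n j _ (fun s => 0 * nonincr_weight R s)); last first.
  by move=> s _; rewrite /nonincr_weight /= !mul0r.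
rewrite nested_sumZ mul0r add0r; apply: eq_big_nat => i /andP[_ ltin].
rewrite mzeta_star_ones_nested -(@nested_sum_le _ n i.+1) // -nested_sumZ.
apply: eq_nested_sum => s _; rewrite /nonincr_weight /= big_cons.
rewrite (path_sortedE geq_trans) (eq_all (a2 := fun x => x <= i.+1)%N) //.
by case: all; case: positive; case: sorted; rewrite /= ?(mul0r, mulr0, mul1r).
Qed.

(** Coefficientwise form of P_(n+1) = (1 + x/(n+1)) P_n. *)
Lemma mzeta_ones_recr (R : realType) (n j : nat) :
  mzeta R n.+1 (nseq j.+1 1%N) =
  mzeta R n (nseq j.+1 1%N) + n.+1%:R^-1 * mzeta R n (nseq j 1%N).
Proof. by rewrite !mzeta_onesS big_nat_recr. Qed.

(** Coefficientwise form of 1/P_n(-x) = (1 - x/(n+1)) / P_(n+1)(-x). *)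
Lemma mzeta_star_ones_recr (R : realType) (n j : nat) :
  mzeta_star R n.+1 (nseq j.+1 1%N) =
  mzeta_star R n (nseq j.+1 1%N) + n.+1%:R^-1 * mzeta_star R n.+1 (nseq j 1%N).
Proof. by rewrite [LHS]mzeta_star_onesS big_nat_recr //= -mzeta_star_onesS. Qed.

(** * Recurrence and closed form of the hyperharmonic numbers *)

Definition hyper_weight (R : realType) (m : nat) (s : seq nat) : R :=
  [&& positive s, sorted geq (take m s) & sorted gtn (drop m.-1 s)]%:R *
  \prod_(x <- drop m.-1 s) x%:R^-1.

Lemma hyperharmonic_nested (R : realType) (m k n : nat) :
  hyperharmonic R m k n = nested_sum n (m + k).-1 (hyper_weight R m).
Proof.
rewrite -sum_tuple_nested /hyperharmonic big_mkcond /=.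
apply: eq_bigr => t _; rewrite /hyper_weight.
by case: ifP => _; rewrite ?mul1r ?mul0r.
Qed.

Lemma hyperharmonic1 (R : realType) (k n : nat) :
  hyperharmonic R 1 k n = mzeta R n (nseq k 1%N).
Proof.
rewrite hyperharmonic_nested mzeta_ones_nested; apply: eq_nested_sum => s _.
by rewrite /hyper_weight /decr_weight drop0; case: s => //= x s; rewrite take0.
Qed.

(** When position m exists, its entry is both the last of the weakly decreasing block and the first
    of the strictly decreasing one, so a bound on the former block passes to the latter. *)
Lemma path_take_sorted_drop (i m : nat) (s : seq nat) :
  path geq i (take m.+1 s) && sorted gtn (drop m s) =
  [&& all (fun x => x <= i)%N s, sorted geq (take m.+1 s)
    & sorted gtn (drop m s)].
Proof.
rewrite (path_sortedE geq_trans) -[in all _ s](cat_take_drop m.+1 s) all_cat -!andbA.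
case: (boolP (all (geq i) _)) => //= le_take.
case: sorted => /=; last by rewrite andbF.
case: (boolP (sorted gtn _)) => sgt; rewrite ?andbF // andbT.
have [ltms|lesm] := ltnP m (size s); last first.
  by rewrite drop_oversize // (leq_trans lesm).
move: sgt le_take; rewrite (drop_nth 0%N) //= (path_sortedE gtn_trans) => /andP[].
move=> lt_drop _; rewrite (take_nth 0%N) // all_rcons => /andP[/= nthi _].
apply/esym; apply: sub_all lt_drop => x /= /ltnW ltx; exact: leq_trans nthi.
Qed.

(** With at least two weakly ordered indices, n_1 does not enter the product, so splitting off n_1 =
    i+1 leaves a sum without weights. *)
Lemma hyperharmonicS (R : realType) (m k n : nat) :
  hyperharmonic R m.+2 k n = \sum_(0 <= i < n) hyperharmonic R m.+1 k i.+1.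
Proof.
rewrite hyperharmonic_nested /= big_nat_recl //.
rewrite (eq_nested_sum n (m + k) _ (fun s => 0 * hyper_weight R m.+1 s)); last first.
  by move=> s _; rewrite /hyper_weight /= !mul0r.
rewrite nested_sumZ mul0r add0r; apply: eq_big_nat => i /andP[_ ltin].
rewrite hyperharmonic_nested -(@nested_sum_le _ n i.+1) //=.
apply: eq_nested_sum => s _; rewrite /hyper_weight /= path_take_sorted_drop.
by case: all; case: positive; case: sorted; rewrite /= ?(mul0r, mulr0, mul1r).
Qed.

(* The coefficient of x^k in prod_(1 <= i <= N) (1 + x/i) divided by
   prod_(1 <= i <= r) (1 + x/i). *)
Definition zeta_conv (R : realType) (r N k : nat) : R :=
  \sum_(i < k.+1)
    (-1) ^+ i * mzeta_star R r (nseq i 1%N) * mzeta R N (nseq (k - i) 1%N).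

Lemma zeta_conv0 (R : realType) (r N : nat) : zeta_conv R r N 0 = 1.
Proof.
rewrite /zeta_conv big_ord1 mzeta_ones0.
by rewrite (mzeta_star_ones0 R r) !mulr1.
Qed.

Lemma zeta_conv_numerator (R : realType) (r N k : nat) :
  zeta_conv R r N.+1 k.+1 = zeta_conv R r N k.+1 + N.+1%:R^-1 * zeta_conv R r N k.
Proof.
(* The term i = k+1 has a [mzeta] factor of depth 0, equal to 1 for both N and N+1; it is set aside
   before the recurrence is applied. *)
rewrite /zeta_conv !(big_ord_recr k.+1) /= !subnn !mzeta_ones0 addrAC.
congr (_ + _); rewrite big_distrr -big_split /=; apply: eq_bigr => i _.
by rewrite subSn ?leq_ord // mzeta_ones_recr; ring.
Qed.

(** Reads P_N / P_r = (1 + x/(r+1)) P_N / P_(r+1). *)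
Lemma zeta_conv_denominator (R : realType) (r N k : nat) :
  zeta_conv R r N k.+1 =
  zeta_conv R r.+1 N k.+1 + r.+1%:R^-1 * zeta_conv R r.+1 N k.
Proof.
rewrite /zeta_conv !(big_ord_recl k.+1) /= !mzeta_star_ones0 -addrA.
congr (_ + _); rewrite big_distrr -big_split /=; apply: eq_bigr => i _.
by rewrite /bump /= !add1n subSS mzeta_star_ones_recr exprS; ring.
Qed.

(** The quotient P_r / P_r is 1, so its coefficients of positive degree vanish. *)
Lemma zeta_conv_diag (R : realType) (r k : nat) : zeta_conv R r r k.+1 = 0.
Proof.
elim: r => [|r IHr].
  rewrite /zeta_conv big1 // => i _; case: (nat_of_ord i) => [|i'].
    by rewrite subn0 mzeta_onesS big_geq // mulr0.
  by rewrite mzeta_star_onesS big_geq // mulr0 mul0r.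
(* Gaining the factor 1 + x/(r+1) in the numerator cancels its loss from the denominator, which
   leads back to the diagonal at r. *)
by rewrite zeta_conv_numerator -zeta_conv_denominator.
Qed.

Lemma zeta_conv_r0 (R : realType) (N k : nat) :
  zeta_conv R 0 N k = mzeta R N (nseq k 1%N).
Proof.
rewrite /zeta_conv big_ord_recl /= subn0 (mzeta_star_ones0 R 0) !mul1r.
rewrite big1 ?addr0 // => i _.
by rewrite /bump /= add1n mzeta_star_onesS big_geq // mulr0 mul0r.
Qed.

(** Induction on r, then on n. After both sides are written over P_(r+1), Pascal's rule matches the
    terms in [q], and the absorption identity [binR] those in [q']. *)
Lemma hyperharmonic_closed_form (R : realType) (r k n : nat) :
  hyperharmonic R r.+1 k.+1 n = 'C(n + r, r)%:R * zeta_conv R r (n + r) k.+1.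
Proof.
elim: r n => [|r IHr] n.
  by rewrite addn0 bin0 mul1r hyperharmonic1 zeta_conv_r0.
rewrite hyperharmonicS; elim: n => [|n IHn].
  by rewrite big_geq // add0n zeta_conv_diag mulr0.
rewrite big_nat_recr //= {}IHn {}IHr !addSn !addnS.
rewrite (zeta_conv_denominator R r) (zeta_conv_numerator R r.+1 (n + r).+1).
set q := zeta_conv R r.+1 _ k.+1; set q' := zeta_conv R r.+1 _ k.
have binR : (n + r).+2%:R * 'C((n + r).+1, r)%:R =
    r.+1%:R * 'C((n + r).+2, r.+1)%:R :> R.
  by rewrite -!natrM -mul_bin_diag.
have -> : 'C((n + r).+2, r.+1)%:R * (q + (n + r).+2%:R^-1 * q') =
    'C((n + r).+2, r.+1)%:R * q + 'C((n + r).+1, r)%:R * (r.+1%:R^-1 * q').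
  rewrite mulrDr; congr (_ + _); rewrite !mulrA; congr (_ * _).
  apply: (mulfI (_ : (n + r).+2%:R != 0)); first by rewrite pnatr_eq0.
  rewrite mulrCA mulfV ?pnatr_eq0 // mulr1.
  by rewrite mulrA binR mulrAC mulfV ?pnatr_eq0 // mul1r.
by rewrite [in X in _ = X * q + _]binS natrD; ring.
Qed.

(** * Stirling numbers and the binomial coefficient *)

Lemma prod_binomial (F : numFieldType) (n r : nat) :
  \prod_(1 <= i < r.+1) (1 + i%:R^-1 * n%:R) = 'C(n + r, r)%:R :> F.
Proof.
elim: r => [|r IHr]; first by rewrite big_geq // bin0.
rewrite big_nat_recr //= {}IHr.
apply: (mulfI (_ : r.+1%:R != 0)); first by rewrite pnatr_eq0.
rewrite mulrCA mulrDr mulr1 mulrA mulfV ?pnatr_eq0 // mul1r -natrD -!natrM.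
by rewrite addnS -mul_bin_diag /= mulnC addnC addnS.
Qed.

Lemma size_prod_linear (F : idomainType) (c : nat -> F) (r : nat) :
  (size (\prod_(1 <= i < r.+1) (1 + c i *: 'X) : {poly F})%R <= r.+1)%N.
Proof.
elim: r => [|r IHr]; first by rewrite big_geq // size_poly1.
rewrite big_nat_recr //=; apply: leq_trans (size_polyMleq _ _) _.
have : (size (1 + c r.+1 *: 'X : {poly F})%R <= 2)%N.
  rewrite (leq_trans (size_polyD _ _)) // geq_max size_poly1 /=.
  by rewrite (leq_trans (size_scale_leq _ _)) // size_polyX.
move=> le2; rewrite -subn1 leq_subLR (leq_trans (leq_add IHr le2)) //.
by rewrite addn2.
Qed.

Lemma stirling1_binomial (R : realType) (r n : nat) : (0 < n)%N ->
  \sum_(1 <= l < r.+2) stirling1 R r.+1 l * n%:R ^+ l.-1 =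
  r`!%:R * 'C(n + r, r)%:R.
Proof.
move=> n_gt0; have n_neq0 : n%:R != 0 :> R by rewrite pnatr_eq0 -lt0n.
(* Multiplying by n turns the left side into the defining polynomial of the Stirling row evaluated
   at n; its constant coefficient is 0. *)
apply: (mulfI n_neq0); rewrite big_distrr /=.
pose P : {poly R} := r`!%:R *: ('X * \prod_(1 <= i < r.+1) (1 + i%:R^-1 *: 'X)).
have sizeP : (size P <= r.+2)%N.
  rewrite (leq_trans (size_scale_leq _ _)) //.
  rewrite (leq_trans (size_polyMleq _ _)) // size_polyX /= ltnS.
  exact: size_prod_linear.
have : P.[n%:R] = n%:R * (r`!%:R * 'C(n + r, r)%:R).
  rewrite hornerZ hornerM hornerX horner_prod mulrCA -prod_binomial.
  by do 2!congr (_ * _); apply: eq_bigr => i _; rewrite !hornerE.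
move=> <-; rewrite (horner_coef_wide _ sizeP).
rewrite -(big_mkord xpredT (fun l => P`_l * n%:R ^+ l)) [RHS]big_ltn //.
rewrite {1}/P coefZ coefXM eqxx mulr0 mul0r add0r.
by apply: eq_big_nat => -[|l] // _; rewrite mulrCA -exprS.
Qed.

(** * Convergence of the series U *)

Definition half_prod (F : numFieldType) (N : nat) : F :=
  \prod_(0 <= i < N) (1 + (2 * i.+1%:R)^-1).

Lemma half_prodS (F : numFieldType) (N : nat) :
  half_prod F N.+1 = half_prod F N * (1 + (2 * N.+1%:R)^-1).
Proof. by rewrite /half_prod big_nat_recr. Qed.

Lemma half_prod_ge1 (F : numFieldType) (N : nat) : 1 <= half_prod F N.
Proof.
elim: N => [|N IHN]; first by rewrite /half_prod big_geq.
by rewrite half_prodS mulr_ege1 // lerDl invr_ge0 mulr_ge0.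
Qed.

Lemma mzeta_ones_ge0 (R : realType) (n j : nat) : 0 <= mzeta R n (nseq j 1%N).
Proof.
elim: j n => [|j IHj] n; first by rewrite mzeta_ones0.
by rewrite mzeta_onesS sumr_ge0 // => i _; rewrite mulr_ge0 ?invr_ge0.
Qed.

(* The left-hand side is a coefficient of prod_(1 <= i <= N) (1 + x/i), which is
   evaluated at x = 1/2 to keep the growth below a power N^s with s < 1. *)
Lemma mzeta_ones_le (R : realType) (N j : nat) :
  mzeta R N (nseq j 1%N) <= 2 ^+ j * half_prod R N.
Proof.
elim: N j => [|N IHN] [|j].
- by rewrite mzeta_ones0 mul1r half_prod_ge1.
- by rewrite mzeta_onesS big_geq // mulr_ge0 ?exprn_ge0 // (le_trans ler01) // half_prod_ge1.
- by rewrite mzeta_ones0 mul1r half_prod_ge1.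
have N_neq0 : N.+1%:R != 0 :> R by rewrite pnatr_eq0.
have -> : 2 ^+ j.+1 * half_prod R N.+1 =
    2 ^+ j.+1 * half_prod R N + N.+1%:R^-1 * (2 ^+ j * half_prod R N).
  by rewrite half_prodS exprS; field.
by rewrite mzeta_ones_recr lerD // ler_wpM2l ?invr_ge0.
Qed.

(* With n = x + 1, the weight 1/n^2 of the n-th term is paid for by the decrease
   of 2 half_prod (n + r) / n. *)
Lemma telescoping_bound (F : realFieldType) (x : F) : 0 < x ->
  (1 + (2 * (x + 1))^-1) * (((x + 1) ^+ 2)^-1 + 2 / (x + 1)) <= 2 / x.
Proof.
move=> x_gt0; have x_neq0 : x != 0 by rewrite gt_eqF.
have x1_gt0 : 0 < x + 1 by rewrite addr_gt0.
have x1_neq0 : x + 1 != 0 by rewrite gt_eqF.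
rewrite -subr_ge0.
have -> : 2 / x - (1 + (2 * (x + 1))^-1) * (((x + 1) ^+ 2)^-1 + 2 / (x + 1)) =
    (4 * (x + 1) ^+ 3 - (2 * x + 3) ^+ 2 * x) / (2 * x * (x + 1) ^+ 3).
  by field; rewrite x1_neq0.
(* The cubic and quadratic terms cancel. A constant below 2 in place of the 2 in 2/x and 2/(x+1)
   would leave a negative quadratic term. *)
have -> : 4 * (x + 1) ^+ 3 - (2 * x + 3) ^+ 2 * x = 3 * x + 4 by ring.
by rewrite divr_ge0 ?mulr_ge0 ?exprn_ge0 ?addr_ge0 ?mulr_ge0 // ltW.
Qed.

Lemma half_prod_sum_le (F : realFieldType) (r N : nat) :
  \sum_(1 <= n < N.+2) half_prod F (n + r) / n%:R ^+ 2
    + 2 * half_prod F (N.+1 + r) / N.+1%:R <= 3 * half_prod F (1 + r).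
Proof.
(* At N = 0 the constant 3 is 1 from the term n = 1 plus 2 from the correction. *)
elim: N => [|N IHN]; first by rewrite big_nat1 expr1n !divr1; lra.
apply: le_trans IHN; rewrite big_nat_recr //= -addrA lerD2l.
rewrite [half_prod F (N.+2 + r)]half_prodS -/addn -addSn.
set b := half_prod F _; set x : F := N.+1%:R.
have x_gt0 : 0 < x by rewrite ltr0n.
have b_ge0 : 0 <= b by rewrite (le_trans ler01) // half_prod_ge1.
have -> : N.+2%:R = x + 1 :> F by rewrite -natr1.
have x1_gt0 : 0 < x + 1 by rewrite addr_gt0.
set c := 1 + (2 * (N.+1 + r).+1%:R)^-1.
(* The shift by r only brings the new factor closer to 1. *)
have c_le : c <= 1 + (2 * (x + 1))^-1.
  rewrite lerD2l lef_pV2 ?posrE ?mulr_gt0 // ler_pM2l // -natr1 lerD2r.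
  by rewrite ler_nat leq_addr.
have -> : b * c / (x + 1) ^+ 2 + 2 * (b * c) / (x + 1) =
    b * (c * (((x + 1) ^+ 2)^-1 + 2 / (x + 1))) by ring.
have -> : 2 * b / x = b * (2 / x) by ring.
rewrite ler_wpM2l // (le_trans _ (telescoping_bound _ x x_gt0)) // ler_wpM2r //.
by rewrite addr_ge0 ?divr_ge0 ?invr_ge0 ?exprn_ge0 // ltW.
Qed.

(** The partial sums are nondecreasing, and q = 2 is the worst case, bounded by
    [half_prod_sum_le]. *)
Lemma U_partial_cvg (R : realType) (j r q : nat) : (2 <= q)%N ->
  cvgn (U_partial R j r q).
Proof.
move=> q_ge2.
have term_ge0 n : 0 <= mzeta R (n + r) (nseq j 1%N) / n%:R ^+ q.
  by rewrite divr_ge0 ?mzeta_ones_ge0 ?exprn_ge0.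
have U_nd : nondecreasing_seq (U_partial R j r q).
  apply/nondecreasing_seqP => -[|N]; rewrite /U_partial; first by rewrite !big_geq.
  by rewrite [leRHS]big_nat_recr //= lerDl.
apply: nondecreasing_is_cvgn => //.
exists (2 ^+ j * (3 * half_prod R (1 + r))) => _ [N _ <-].
have hp_ge0 M : 0 <= half_prod R M by rewrite (le_trans ler01) // half_prod_ge1.
apply: (@le_trans _ _ (U_partial R j r q N.+2)).
  by apply: U_nd; rewrite !leqW.
apply: (@le_trans _ _
    (2 ^+ j * \sum_(1 <= n < N.+2) half_prod R (n + r) / n%:R ^+ 2)).
  rewrite big_distrr /=; apply: ler_sum_nat => n /andP[n_gt0 _].
  rewrite mulrA ler_pM ?mzeta_ones_ge0 ?mzeta_ones_le ?invr_ge0 ?exprn_ge0 //.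
  by rewrite lef_pV2 ?posrE ?exprn_gt0 ?ltr0n // ler_weXn2l // ler1n.
rewrite ler_wpM2l ?exprn_ge0 // (le_trans _ (half_prod_sum_le R r N)) // lerDl.
by rewrite divr_ge0 ?mulr_ge0.
Qed.

(** * Identity for partial sums and passage to the limit *)

Lemma sum_antidiagonal (V : nmodType) (k : nat) (f : nat -> nat -> V) :
  \sum_(i < k.+1) \sum_(j < k.+1 | (i + j == k)%N) f i j =
  \sum_(i < k.+1) f i (k - i)%N.
Proof.
apply: eq_bigr => i _; have ik : (k - i < k.+1)%N by rewrite ltnS leq_subr.
rewrite (big_pred1 (Ordinal ik)) // => j /=.
by rewrite -val_eqE /= -(eqn_add2l i (val j)) subnKC // leq_ord.
Qed.

Lemma S_partial_U_partial (R : realType) (k r p N : nat) : (r.+2 <= p)%N ->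
  S_partial R k.+1 r.+1 p N =
  r`!%:R^-1 * \sum_(1 <= l < r.+2) stirling1 R r.+1 l *
    \sum_(i < k.+2) (-1) ^+ i * mzeta_star R r (nseq i 1%N) *
      U_partial R (k.+1 - i) r (p + 1 - l) N.
Proof.
move=> rp; rewrite /S_partial.
have distr l : stirling1 R r.+1 l *
    \sum_(i < k.+2) (-1) ^+ i * mzeta_star R r (nseq i 1%N) *
      U_partial R (k.+1 - i) r (p + 1 - l) N =
    \sum_(1 <= n < N) stirling1 R r.+1 l *
      (zeta_conv R r (n + r) k.+1 / n%:R ^+ (p + 1 - l)).
  rewrite -big_distrr /=; congr (_ * _).
  under [RHS]eq_bigr do rewrite /zeta_conv big_distrl /=.
  rewrite exchange_big /=; apply: eq_bigr => i _.
  by rewrite big_distrr /=; apply: eq_bigr => n _; rewrite mulrA.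
rewrite (eq_bigr _ (fun l _ => distr l)) exchange_big big_distrr /=.
apply: eq_big_nat => n /andP[n_gt0 _].
have n_neq0 : n%:R != 0 :> R by rewrite pnatr_eq0 -lt0n.
have fact_neq0 : r`!%:R != 0 :> R by rewrite pnatr_eq0 -lt0n fact_gt0.
rewrite hyperharmonic_closed_form.
have -> : \sum_(1 <= l < r.+2) stirling1 R r.+1 l *
      (zeta_conv R r (n + r) k.+1 / n%:R ^+ (p + 1 - l)) =
    (r`!%:R * 'C(n + r, r)%:R) * (zeta_conv R r (n + r) k.+1 / n%:R ^+ p).
  rewrite -stirling1_binomial // big_distrl /=.
  apply: eq_big_nat => -[|l] // /andP[_ lr]; rewrite -mulrA; congr (_ * _).
  rewrite mulrCA; congr (_ * _); rewrite addn1 subSS /=.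
  (* The summation index is now l+1, so the exponent is p - l; this bound keeps the natural
     subtraction from truncating. *)
  have lp : (l <= p)%N := leq_trans (ltnW (ltnW lr)) rp.
  by rewrite -[in RHS](subnK lp) exprD; field; rewrite !expf_neq0.
by rewrite !mulrA mulVf // mul1r.
Qed.

Theorem theorem1p1 (R : realType) (k r p : nat)
    (hk : (1 <= k)%N) (hp : (r + 2 <= p)%N) :
  [/\ cvgn (S_partial R k (r + 1) p),
      (forall j l : nat, (j <= k)%N -> (1 <= l <= r + 1)%N ->
         cvgn (U_partial R j r (p + 1 - l)))
    & S_sum R k (r + 1) p =
      (r`!)%:R^-1 *
      \sum_(1 <= l < r + 2)
        stirling1 R (r + 1) l *
        \sum_(i < k.+1) \sum_(j < k.+1 | (i + j == k)%N)
          (-1) ^+ i * mzeta_star R r (nseq i 1%N) *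
          U_sum R j r (p + 1 - l)].
Proof.
case: k hk => // k _; move: hp; rewrite addn2 addn1 => hp.
have U_cvg j l : (1 <= l < r.+2)%N -> cvgn (U_partial R j r (p + 1 - l)).
  move=> /andP[_ lr]; apply: U_partial_cvg.
  (* Since l <= r+1 < p, the exponent p+1-l is at least 2. *)
  have lp : (l < p)%N := leq_trans lr hp.
  by rewrite addn1 subSn ?(ltnW lp) // ltnS subn_gt0.
have S_cvg : (S_partial R k.+1 r.+1 p @ \oo --> r`!%:R^-1 *
    \sum_(1 <= l < r.+2) stirling1 R r.+1 l *
      \sum_(i < k.+2) (-1) ^+ i * mzeta_star R r (nseq i 1%N) *
        U_sum R (k.+1 - i) r (p + 1 - l))%classic.
  (* Membership of l in the range is recorded in the sums because [U_cvg] requires it. *)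
  rewrite big_seq; under eq_cvg do rewrite S_partial_U_partial // big_seq.
  apply: cvgMl_tmp.
  apply: cvg_big => [|l]; first exact: add_continuous.
  rewrite mem_index_iota => lr; apply: cvgMl_tmp.
  apply: cvg_big => [|i _]; first exact: add_continuous.
  by apply: cvgMl_tmp; apply: U_cvg.
split.
- exact: cvgP S_cvg.
- by move=> j l _ lr; apply: U_cvg; rewrite ltnS.
rewrite /S_sum (cvg_lim _ S_cvg) //; congr (_ * _).
apply: eq_bigr => l _; congr (_ * _); apply/esym.
exact: (sum_antidiagonal _ k.+1 (fun i j =>
  (-1) ^+ i * mzeta_star R r (nseq i 1%N) * U_sum R j r (p + 1 - l))).
Qed.
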